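(* Let $\alpha\in\mathbb{C}$ with $|\alpha|>1$, and let $n$ be an integer with $n\ge N_2(\alpha)$, where $$N_2(\alpha)=\frac{20\log(|\alpha|+1)-4\log(\log|\alpha|)}{\log|\alpha|}.$$ Then $$\lambda_{\alpha,n,1}<0,\qquad \lambda_{\alpha,n,n}>4,$$ whereas for $2\le j\le n-1$ the eigenvalues $\lambda_{\alpha,n,j}$ belong to $(0,4)$ and satisfy $$g\left(\frac{(j-1)\pi}{n}\right)<\lambda_{\alpha,n,j}<g\left(\frac{j\pi}{n}\right).$$
   Context: For $\alpha\in\mathbb{C}$ and an integer $n\ge 3$, $A_{\alpha,n}$ is the $n\times n$ complex matrix with all main diagonal entries equal to $2$, all entries on the first subdiagonal and on the first superdiagonal equal to $-1$, the $(1,n)$ entry equal to $-\overline{\alpha}$, the $(n,1)$ entry equal to $-\alpha$, and all other entries $0$. It is Hermitian, and its (real) eigenvalues, counted with multiplicity, are enumerated in ascending order: $\lambda_{\alpha,n,1}\le\cdots\le\lambda_{\alpha,n,n}$. The function $g$ is $g(x)=4\sin^2(x/2)$. Throughout $n\ge3$, and $\log$ is the natural logarithm. *)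

(* Defs.v *)
From mathcomp Require Import all_boot all_order all_algebra.
From mathcomp Require Import spectral complex.
From mathcomp Require Import reals exp trigo.

Set Implicit Arguments.
Unset Strict Implicit.
Unset Printing Implicit Defensive.

Import Order.TTheory GRing.Theory Num.Theory.
Import ComplexField.Normc.

Local Open Scope ring_scope.
Local Open Scope complex_scope.

(* Rows and columns are indexed from 0: the entries (1,n) and (n,1) of the
   usual notation are those with (i, j) = (0, n-1) and (n-1, 0).  For 3 <= n
   the cases below do not overlap. *)
Definition A_mx (R : realType) (alpha : R[i]) (n : nat) : 'M[R[i]]_n :=
  \matrix_(i < n, j < n)
    if i == j then 2
    else if (i == j.+1 :> nat) || (j == i.+1 :> nat) then -1
    else if (i == 0%N :> nat) && (j == n.-1 :> nat) then - alpha^*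
    else if (i == n.-1 :> nat) && (j == 0%N :> nat) then - alpha
    else 0.

(* Real parts, in ascending order, of the roots of the characteristic
   polynomial, with multiplicity.  Taking real parts only changes the type when
   the eigenvalues are real; see [char_poly_eigvals] for Hermitian matrices. *)
Definition eigvals (R : realType) (n : nat) (M : 'M[R[i]]_n) : seq R :=
  sort <=%R [seq complex.Re z | z <- sval (closed_field_poly_normal (char_poly M))].

(* The j-th smallest eigenvalue; j is counted from 1, meaningful for
   1 <= j <= n only. *)
Definition lambda (R : realType) (alpha : R[i]) (n j : nat) : R :=
  (eigvals (A_mx alpha n))`_j.-1.

Definition g (R : realType) (x : R) : R := 4 * sin (x / 2) ^+ 2.

Definition N2 (R : realType) (alpha : R[i]) : R :=
  (20 * ln (normc alpha + 1) - 4 * ln (ln (normc alpha))) / ln (normc alpha).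

Lemma A_mx_hermitian (R : realType) (alpha : R[i]) (n : nat) :
  (3 <= n)%N -> A_mx alpha n \is hermsymmx.
Proof.
move=> n3; apply/is_hermitianmxP; apply/matrixP => i j.
rewrite expr0 scale1r !mxE /= [j == i]eq_sym.
have -> : Num.conj = @conjc R by [].
case: eqVneq => [_|ne_ij]; first by rewrite rmorph_nat.
rewrite [(j == i.+1 :> nat) || _]orbC.
case: ifP => _; first by rewrite rmorphN rmorph1.
rewrite [(j == 0%N :> nat) && _]andbC [(j == n.-1 :> nat) && _]andbC.
have n0 : (0%N == n.-1) = false by case: n n3 {i j ne_ij} => [|[|n]].
case: (eqVneq (i : nat) 0%N) => [->|_] /=; case: (eqVneq (i : nat) n.-1) => [_|_];
  rewrite ?n0 ?andbF ?andbT; try case: ifP => _;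
  by rewrite ?andFb ?rmorphN ?rmorph0 //= conjcK.
Qed.

Lemma char_poly_eigvals (R : realType) (n : nat) (M : 'M[R[i]]_n) :
  M \is hermsymmx ->
  char_poly M = \prod_(x <- eigvals M) ('X - (x%:C)%:P).
Proof.
move=> hM; rewrite /eigvals; case: closed_field_poly_normal => r /= Er.
move: Er; rewrite (monicP (char_poly_monic M)) scale1r => Er.
rewrite Er (perm_big _ (permEl (perm_sort _ _))) /= big_map.
rewrite !big_seq; apply: eq_bigr => z z_r; congr ('X - _%:P).
suff /complex_realP[x ->] : z \is Num.real by [].
have : eigenvalue M z by rewrite eigenvalue_root_char Er root_prod_XsubC.
move=> /eigenvalueP[v vM v0].
have /orthomx_spectralP ME := hermitian_normalmx hM.
have /mxOverP Dreal := hermitian_spectral_diag_real hM.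
set P := spectralmx M in ME; set D := spectral_diag M in ME Dreal.
have Pu : P \in unitmx by exact: spectral_unit.
have wD : (v *m invmx P) *m diag_mx D = z *: (v *m invmx P).
  by rewrite scalemxAl -vM [in RHS]ME !mulmxA mulmxK.
have [i wi] : exists i, (v *m invmx P) 0 i != 0.
  apply/rV0Pn; apply: contraNneq v0 => w0.
  by rewrite -(mulmxKV Pu v) w0 mul0mx.
have /matrixP/(_ 0 i) := wD; rewrite mul_mx_diag !mxE mulrC => e.
suff -> : z = D 0 i by exact: Dreal.
by apply: (mulIf wi); rewrite !mxE.
Qed.

Lemma eigvals_sorted (R : realType) (n : nat) (M : 'M[R[i]]_n) :
  sorted <=%R (eigvals M).
Proof. exact/sort_sorted/le_total. Qed.

Lemma size_eigvals (R : realType) (n : nat) (M : 'M[R[i]]_n) :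
  size (eigvals M) = n.
Proof.
rewrite size_sort size_map; case: closed_field_poly_normal => r /= Er.
have := size_char_poly M; rewrite Er (monicP (char_poly_monic M)) scale1r.
by rewrite size_prod_XsubC => -[].
Qed.

(* Main.v *)
Require Import Defs.
From mathcomp Require Import all_boot all_order all_algebra.
From mathcomp Require Import complex.
From mathcomp Require Import reals exp trigo.
From mathcomp Require Import ring lra zify.

(** Put [t = 2 - x] and let [U_k] be the Chebyshev polynomials of the second
    kind.  Expanding the determinant of a tridiagonal matrix with two extra
    corner entries gives
      [det (A - x) = U_n (t/2) - |alpha|^2 U_(n-2) (t/2) - 2 Re alpha],
    the function called [secular] below.  The determinant itself is never
    expanded: a root of [secular] makes a 2 x 2 system of boundary conditions
    singular, and its kernel provides an explicit eigenvector
    ([A_mx_eigenvalue]).  It is then enough to exhibit [n] roots in separated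
    places: being [n] distinct eigenvalues, they are all of them, in order
    ([nth_sorted_increasing]).

    The roots come from [n] sign changes.  At [x = g (k pi / n)], that is
    [t = 2 cos (k pi / n)], the value is [(-1)^k (1 + |alpha|^2) - 2 Re alpha]
    ([secular_cos]), whose sign is [(-1)^k] because [2 |alpha| < 1 + |alpha|^2].
    This gives a root in each of the [n - 2] intervals between consecutive
    nodes with [0 < k < n].  The other two lie outside [0, 4]: the value at
    [x = 0] is at most [(n + 1) - |alpha|^2 (n - 1) + 2 |alpha|], which is
    negative exactly when [n (|alpha| - 1) > |alpha| + 1], whereas the leading
    behaviour makes it positive far to the left; the reflection [t -> - t]
    turns this into the same statement to the right of [4].

    The bound by [N2] enters through its consequence
    [n (|alpha| - 1) > |alpha| + 1], which follows from [ln y <= y - 1]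
    ([N2_large]). *)

Set Implicit Arguments.
Unset Strict Implicit.
Unset Printing Implicit Defensive.

Import Order.TTheory GRing.Theory Num.Theory.
Import ComplexField.Normc.

Local Open Scope ring_scope.
Local Open Scope complex_scope.

(** * Chebyshev polynomials of the second kind *)

(** [cheb t k] is [U_(k-1) (t/2)].  The shifted index makes the recurrence start
    from 0 and 1, and turns the trigonometric formula into
    [sin (k x) / sin x].  The ring is arbitrary so that the same function can be
    used on numbers and on polynomials. *)
Fixpoint cheb (A : pzRingType) (t : A) (k : nat) : A :=
  match k with
  | 0%N => 0
  | k'.+1 => if k' is k''.+1 then t * cheb t k' - cheb t k'' else 1
  end.

Lemma chebSS (A : pzRingType) (t : A) k :
  cheb t k.+2 = t * cheb t k.+1 - cheb t k.
Proof. by []. Qed.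

Lemma cheb_ind2 (P : nat -> Prop) :
  P 0%N -> P 1%N -> (forall k, P k -> P k.+1 -> P k.+2) -> forall k, P k.
Proof.
move=> P0 P1 PS k; suff [] : P k /\ P k.+1 by [].
by elim: k => [|k [Pk Pk1]]; split=> //; apply: PS.
Qed.

Lemma rmorph_cheb (A B : pzRingType) (f : {rmorphism A -> B}) (t : A) k :
  f (cheb t k) = cheb (f t) k.
Proof.
elim/cheb_ind2: k => [||k IH0 IH1]; rewrite ?rmorph0 ?rmorph1 //.
by rewrite !chebSS rmorphB rmorphM IH0 IH1.
Qed.

(** The left side is a determinant of two consecutive solutions of the
    recurrence, whose transition matrix has determinant 1. *)
Lemma cheb_cassini (A : comPzRingType) (t : A) k :
  cheb t k.+1 ^+ 2 - cheb t k.+2 * cheb t k = 1.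
Proof.
elim: k => [|k IH]; first by rewrite /= mulr0 subr0 expr1n.
by rewrite -[RHS]IH !chebSS; ring.
Qed.

(** [U_k] has the parity of [k]. *)
Lemma cheb_opp (A : comPzRingType) (t : A) k :
  cheb (- t) k.+1 = (-1) ^+ k * cheb t k.+1.
Proof.
elim/cheb_ind2: k => [||k IH0 IH1]; first by rewrite mul1r.
  by rewrite !chebSS expr1 /=; ring.
by rewrite chebSS IH0 IH1 [cheb t k.+3]chebSS !exprS; ring.
Qed.

Lemma cheb2 (A : comPzRingType) k : cheb (2 : A) k = k%:R.
Proof.
elim/cheb_ind2: k => [||k IH0 IH1] //.
by rewrite chebSS IH0 IH1 -[k.+2]addn2 -[k.+1]addn1 !natrD; ring.
Qed.

Lemma sin_cheb (R : realType) (x : R) k :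
  cheb (2 * cos x) k * sin x = sin (k%:R * x).
Proof.
elim/cheb_ind2: k => [||k IH0 IH1]; [by rewrite !mul0r sin0|by rewrite !mul1r|].
rewrite chebSS mulrBl -mulrA IH0 IH1.
have -> : k.+2%:R * x = k.+1%:R * x + x by rewrite -(natr1 k.+1); ring.
have -> : k%:R * x = k.+1%:R * x - x by rewrite -(natr1 k); ring.
by rewrite sinB sinD; ring.
Qed.

(** For [2 <= t] the recurrence preserves growth by at least 1, since
    [cheb t k.+2 - cheb t k.+1
       = (t - 2) cheb t k.+1 + (cheb t k.+1 - cheb t k)]. *)
Lemma cheb_growth (R : realDomainType) (t : R) k : 2 <= t ->
  0 <= cheb t k /\ cheb t k + 1 <= cheb t k.+1.
Proof.
move=> t2; elim: k => [|k [IH0 IH1]]; first by rewrite /= add0r.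
split; first lra.
rewrite chebSS; have : 0 <= (t - 2) * cheb t k.+1.
  by apply: mulr_ge0; lra.
lra.
Qed.

(** * The secular function and its signs *)

(** For [c = |alpha|^2] and [s = 2 Re alpha] this is [det (A - x)], where [A] is
    the matrix of the theorem and [t = 2 - x]. *)
Definition secular (A : comPzRingType) (c s : A) (n : nat) (t : A) : A :=
  cheb t n.+1 - c * cheb t n.-1 - s.

Lemma rmorph_secular (A B : comPzRingType) (f : {rmorphism A -> B}) (c s t : A) n :
  f (secular c s n t) = secular (f c) (f s) n (f t).
Proof. by rewrite /secular !rmorphB rmorphM !rmorph_cheb. Qed.

(** The reflection of the spectrum about 2 only changes the sign of [s], which is
    why the two ends of the spectrum can be treated by the same estimates. *)
Lemma secular_opp (A : comPzRingType) (c s t : A) n : (1 < n)%N ->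
  (-1) ^+ n * secular c s n (- t) = secular c ((-1) ^+ n * s) n t.
Proof.
case: n => [|[|n]] // _; rewrite /secular !cheb_opp !exprS.
by transitivity ((-1 : A) ^+ n ^+ 2 * (cheb t n.+3 - c * cheb t n.+1)
    - (-1) * (-1 * (-1) ^+ n) * s); [ring|rewrite sqrr_sign; ring].
Qed.

(** At these nodes [sin ((n +- 1) x) = +- (-1)^k sin x], so that all dependence
    on the node but its parity disappears. *)
Lemma secular_cos (R : realType) (c s : R) n k : (0 < k < n)%N ->
  secular c s n (2 * cos (k%:R * pi / n%:R)) = (-1) ^+ k * (1 + c) - s.
Proof.
move=> /andP[k0 kn]; set x := k%:R * pi / n%:R.
have n0 : 0 < n%:R :> R by rewrite ltr0n (leq_trans _ kn).
have pi0 := pi_gt0 R.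
have sx : 0 < sin x.
  apply: sin_gt0_pi; apply/andP; split.
    by apply: divr_gt0 n0; apply: mulr_gt0 pi0; rewrite ltr0n.
  by rewrite ltr_pdivrMr // mulrC ltr_pM2l // ltr_nat.
have nx : n%:R * x = pi *+ k by rewrite /x mulrC divfK ?gt_eqF // mulr_natl.
have up : sin (n.+1%:R * x) = (-1) ^+ k * sin x.
  by rewrite -natr1 mulrDl mul1r nx addrC (alternatingn (@sinDpi R)).
have dn : sin (n.-1%:R * x) = - ((-1) ^+ k * sin x).
  have -> : n.-1%:R * x = - x + pi *+ k.
    by rewrite -nx -{2}(ltn_predK kn) -natr1; ring.
  by rewrite (alternatingn (@sinDpi R)) sinN mulrN.
apply: (mulIf (lt0r_neq0 sx)).
by rewrite /secular !mulrBl -mulrA !sin_cheb up dn; ring.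
Qed.

(** Up to the term [s], bounded by [2 a], the value is
    [(n + 1) - a^2 (n - 1)], and
    [(n + 1) - a^2 (n - 1) + 2 a = (a + 1) (a + 1 - n (a - 1))]. *)
Lemma secular_two_lt0 (R : realFieldType) (a s : R) n : (0 < n)%N -> 1 < a ->
  `|s| <= 2 * a -> a + 1 < n%:R * (a - 1) -> secular (a ^+ 2) s n 2 < 0.
Proof.
move=> n0 a1 sa big; rewrite /secular !cheb2.
have -> : n.-1%:R = n%:R - 1 :> R by rewrite -{2}(prednK n0) -natr1; ring.
rewrite -natr1; have : 0 < (a + 1) * (n%:R * (a - 1) - (a + 1)).
  by apply: mulr_gt0; lra.
by move: sa; rewrite ler_norml => /andP[s1 s2]; nra.
Qed.

(** Since [cheb] increases, [cheb t n.+1 >= (t - 1)^2 cheb t n.-1].  For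
    [t = a + 3] the factor [(a + 2)^2 - a^2 = 4 a + 4] beats [s]. *)
Lemma secular_far_gt0 (R : realFieldType) (a s : R) n : (1 < n)%N -> 1 < a ->
  `|s| <= 2 * a -> 0 < secular (a ^+ 2) s n (a + 3).
Proof.
case: n => [|[|n]] // _ a1 sa; rewrite /secular /=.
move: sa; rewrite ler_norml => /andP[s1 s2].
have t2 : 2 <= a + 3 by lra.
have [m0 m1] := cheb_growth n t2.
rewrite -/(cheb (a + 3) n.+1).
set u := cheb _ n.+1 in m1 *; set v := cheb _ n in m0 m1 *.
nra.
Qed.

Lemma gE (R : realType) (x : R) : g x = 2 - 2 * cos x.
Proof.
have {2}-> : x = (x / 2) *+ 2 by rewrite -mulr_natr divfK ?pnatr_eq0.
by rewrite cos_mulr2n /g sin2cos2; ring.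
Qed.

(** * Eigenvectors *)

Lemma sum_ord_delta (A : pzRingType) n (w : nat -> A) (c : A) k :
  \sum_(i < n) w i * (c *+ (i == k :> nat)) = (w k * c) *+ (k < n)%N.
Proof.
case: ltnP => [kn|nk].
  rewrite (bigD1 (Ordinal kn)) //= eqxx big1 ?addr0 // => i ne_ik.
  by rewrite -val_eqE /= in ne_ik; rewrite (negPf ne_ik) mulr0.
by apply: big1 => i _; rewrite ltn_eqF ?mulr0 // (leq_trans (ltn_ord i)).
Qed.

Lemma row_mul_three (A : pzRingType) n (M : 'M[A]_n) (w : nat -> A) (j : 'I_n)
    (c1 c2 c3 : A) k1 k2 k3 :
  (k1 < n)%N -> (k2 < n)%N -> (k3 < n)%N ->
  (forall i, M i j = c1 *+ (i == k1 :> nat) + c2 *+ (i == k2 :> nat)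
                     + c3 *+ (i == k3 :> nat)) ->
  ((\row_(i < n) w i) *m M) 0 j = w k1 * c1 + w k2 * c2 + w k3 * c3.
Proof.
move=> h1 h2 h3 Mj; rewrite mxE.
under eq_bigr do rewrite mxE Mj !mulrDr.
by rewrite !big_split /= !sum_ord_delta h1 h2 h3.
Qed.

Lemma kernel_2x2 (F : fieldType) (a b c d : F) : a * d - b * c = 0 ->
  exists p q, [/\ (p != 0) || (q != 0), p * a + q * c = 0 & p * b + q * d = 0].
Proof.
move=> det0.
have [ac|] := boolP ((c != 0) || (- a != 0)).
  by exists c, (- a); split=> //; [|rewrite -[RHS]oppr0 -det0]; ring.
rewrite negb_or !negbK oppr_eq0 => /andP[/eqP-> /eqP->].
have [bd|] := boolP ((d != 0) || (- b != 0)).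
  by exists d, (- b); split=> //; ring.
rewrite negb_or !negbK oppr_eq0 => /andP[/eqP-> /eqP->].
by exists 1, 0; rewrite oner_eq0; split=> //; ring.
Qed.

(** The general solution of [w_(k+2) = t w_(k+1) - w_k], with [w_0 = x] and,
    extending it to the left, [w_(-1) = - y]. *)
Definition periodic_sol (A : pzRingType) (t x y : A) (k : nat) : A :=
  x * cheb t k.+1 + y * cheb t k.

(** A row [w] is a left eigenvector for [x] when it solves the three-term
    recurrence with [t = 2 - x] and the twisted periodic conditions
    [w_(-1) = alpha w_(n-1)] and [w_n = conj alpha w_0].  These are two linear
    equations in the two parameters of [periodic_sol]; by [cheb_cassini], their
    determinant is the opposite of [secular]. *)
Lemma A_mx_eigenvalue (R : realType) (alpha : R[i]) n (x : R) : (3 <= n)%N ->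
  secular (normc alpha ^+ 2) (2 * complex.Re alpha) n (2 - x) = 0 ->
  eigenvalue (A_mx alpha n) x%:C.
Proof.
move=> n3 root_x; set t : R[i] := (2 - x)%:C.
have sec0 : secular (alpha * alpha^*) (alpha + alpha^*) n t = 0.
  have -> : alpha * alpha^* = (normc alpha ^+ 2)%:C.
    case: (alpha) => a b; rewrite /normc sqr_sqrtr ?addr_ge0 ?sqr_ge0 //.
    by simpc; congr (_ +i* _); ring.
  have -> : alpha + alpha^* = (2 * complex.Re alpha)%:C.
    by case: (alpha) => a b; simpc; congr (_ +i* _) => /=; ring.
  by rewrite -[LHS](rmorph_secular (real_complex R)) root_x.
have [|p [q [pq0 top bot]]] := @kernel_2x2 _ (alpha * cheb t n)
    (cheb t n.+1 - alpha^*) (alpha * cheb t n.-1 + 1) (cheb t n).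
  have := cheb_cassini t n.-1; rewrite (ltn_predK n3) => cas.
  transitivity (alpha * (cheb t n ^+ 2 - cheb t n.+1 * cheb t n.-1 - 1)
      - secular (alpha * alpha^*) (alpha + alpha^*) n t).
    by rewrite /secular; ring.
  by rewrite cas sec0; ring.
pose w := periodic_sol t p q.
have w_rec k : w k.+2 = t * w k.+1 - w k.
  by rewrite /w /periodic_sol !(chebSS t k.+1) (chebSS t k); ring.
have bd0 : - q = alpha * w n.-1.
  apply/eqP; rewrite eq_sym -subr_eq0 -top /w /periodic_sol (ltn_predK n3).
  by apply/eqP; ring.
have bd1 : w n = alpha^* * w 0%N.
  by apply/eqP; rewrite -subr_eq0 -bot /w /periodic_sol /=; apply/eqP; ring.
have w1 : w 1%N = t * w 0%N + q by rewrite /w /periodic_sol /=; ring.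
have xE : x%:C = 2 - t by rewrite /t rmorphB rmorph_nat opprB addrC subrK.
apply/eigenvalueP; exists (\row_(i < n) w i); last first.
  have n0 : (0 < n)%N by lia.
  have n1 : (1 < n)%N by lia.
  apply: contraTneq pq0 => /rowP w0.
  have := w0 (Ordinal n0); have := w0 (Ordinal n1).
  rewrite !mxE /w /periodic_sol /=.
  rewrite !mulr0 !mulr1 !addr0 subr0 => e1 p0; move: e1.
  by rewrite p0 mul0r add0r => ->; rewrite eqxx.
(* Each column has at most three nonzero entries; the outer columns involve a
   corner, where the boundary conditions replace the recurrence. *)
apply/rowP => j; rewrite [RHS]mxE [X in _ * X]mxE xE.
have jn := ltn_ord j.
have [j0|jpos] := posnP j.
  rewrite (@row_mul_three _ _ _ _ _ 2 (-1) (- alpha) 0 1 n.-1); [|lia..|].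
    by rewrite j0 w1 -[q]opprK bd0; ring.
  move=> i; have := ltn_ord i; rewrite mxE -val_eqE /= j0.
  by repeat (case: eqP => /=); intros;
    rewrite ?(mulr1n, mulr0n, addr0, add0r) //; lia.
have [jl|jnl] := eqVneq (j : nat) n.-1.
  rewrite (@row_mul_three _ _ _ _ _ 2 (-1) (- alpha^*) n.-1 n.-2 0);
    [|lia..|].
    have := w_rec n.-2; have -> : n.-2.+2 = n by lia.
    have -> : n.-2.+1 = n.-1 by lia.
    rewrite jl bd1 => e.
    have -> : w 0%N * - alpha^* = - (alpha^* * w 0%N) by ring.
    by rewrite e; ring.
  move=> i; have := ltn_ord i; rewrite mxE -val_eqE /= jl.
  by repeat (case: eqP => /=); intros;
    rewrite ?(mulr1n, mulr0n, addr0, add0r) //; lia.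
rewrite (@row_mul_three _ _ _ _ _ 2 (-1) (- 1) j j.+1 j.-1); [|lia..|].
  by rewrite -{2 4}(prednK jpos) w_rec (prednK jpos); ring.
move=> i; have := ltn_ord i; rewrite mxE -val_eqE /=.
by repeat (case: eqP => /=); intros;
  rewrite ?(mulr1n, mulr0n, addr0, add0r) //; lia.
Qed.

(** * Locating eigenvalues *)

Lemma mem_eigvals (R : realType) n (M : 'M[R[i]]_n) (x : R) :
  M \is hermsymmx -> eigenvalue M x%:C -> x \in eigvals M.
Proof.
move=> hM; rewrite eigenvalue_root_char (char_poly_eigvals hM).
rewrite -(big_map (fun y : R => y%:C) xpredT (fun z => 'X - z%:P)).
by rewrite root_prod_XsubC mem_map //; exact: complexI.
Qed.

(** [n] distinct members exhaust a list of size [n]; as they are enumerated in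
    increasing order, they agree with the list entry by entry. *)
Lemma nth_sorted_increasing (R : realDomainType) (s : seq R) n (f : 'I_n -> R) :
  sorted <=%R s -> size s = n ->
  {homo f : i k / (i < k)%N >-> i < k} -> (forall i, f i \in s) ->
  forall i : 'I_n, s`_i = f i.
Proof.
move=> s_sorted s_size f_incr f_in i.
have codom_sorted : sorted <%R (codom f).
  rewrite /codom /image_mem sorted_map.
  apply: (@sub_sorted _ (relpre val ltn)) => [k l /f_incr //|].
  by rewrite -sorted_map val_enum_ord iota_ltn_sorted.
have codom_uniq : uniq (codom f) by exact: lt_sorted_uniq codom_sorted.
have sub : {subset codom f <= s} by move=> _ /codomP[k ->].
have sz : size (codom f) = n by rewrite size_codom card_ord.
have [|_ eq_mem] := uniq_min_size codom_uniq sub; first by rewrite s_size sz.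
have s_uniq : uniq s by rewrite -(eq_uniq _ eq_mem) ?sz ?s_size.
have <- : codom f = s.
  apply: le_sorted_eq s_sorted _; last exact: uniq_perm.
  by move: codom_sorted; rewrite lt_sorted_uniq_le => /andP[].
rewrite /codom /image_mem (nth_map i) ?size_enum_ord ?ltn_ord //.
by rewrite nth_ord_enum.
Qed.

(** Over the polynomials, [secular] becomes a polynomial in [x], so that the
    intermediate value property of real closed fields applies. *)
Lemma secular_root (R : rcfType) (c s l r : R) n : l < r ->
  secular c s n (2 - l) * secular c s n (2 - r) < 0 ->
  exists2 x, l < x < r & secular c s n (2 - x) = 0.
Proof.
move=> lr sgn; pose P : {poly R} := secular c%:P s%:P n (2%:P - 'X).
have PE x : P.[x] = secular c s n (2 - x).
  rewrite -horner_evalE (rmorph_secular (horner_eval x)) /= /horner_eval.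
  by rewrite !hornerE.
have [x /andP[lx xr]] : exists2 x, l <= x <= r & root (P.[r] *: P) x.
  apply: poly_ivt; first exact: ltW.
  by rewrite !hornerZ -expr2 sqr_ge0 andbT mulrC !PE ltW.
rewrite rootE hornerZ mulf_eq0 !PE => /orP[|] /eqP x0.
  by rewrite x0 mulr0 ltxx in sgn.
exists x => //; rewrite !lt_neqAle lx xr !andbT; apply/andP; split.
  by apply: contraTneq sgn => ->; rewrite x0 mul0r ltxx.
by apply: contraTneq sgn => <-; rewrite x0 mulr0 ltxx.
Qed.

(** With [L = ln a], [ln L <= L - 1] and [L <= ln (a + 1)], the hypothesis gives
    [n L >= 16 ln (a + 1) + 4], which exceeds [L + 2].  Multiplying by [a - 1] and
    using [2 L <= 2 (a - 1)] gives [n (a - 1) L > (a + 1) L]. *)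
Lemma N2_large (R : realType) (alpha : R[i]) n : 1 < normc alpha ->
  N2 alpha <= n%:R -> normc alpha + 1 < n%:R * (normc alpha - 1).
Proof.
rewrite /N2; set a := normc alpha => a1.
have L0 : 0 < ln a by exact: ln_gt0.
rewrite ler_pdivrMr // => le_n.
have ln_le (x : R) : 0 < x -> ln x <= x - 1.
  by move=> x0; have := @le_ln1Dx R (x - 1); rewrite addrCA subrr addr0; apply; lra.
have La : ln a <= a - 1 by apply: ln_le; lra.
have LL : ln (ln a) <= ln a - 1 by exact: ln_le.
have Lm : ln a <= ln (a + 1) by rewrite ler_ln ?posrE; lra.
have L2 : 1 / 2 <= ln (a + 1).
  have : ln (2^-1 : R) <= 2^-1 - 1 by apply: ln_le; lra.
  rewrite lnV ?posrE // => h2.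
  have : ln (2 : R) <= ln (a + 1) by rewrite ler_ln ?posrE; lra.
  lra.
have key : ln a + 2 < n%:R * ln a by lra.
rewrite -(ltr_pM2r L0).
have : (ln a + 2) * (a - 1) < n%:R * ln a * (a - 1) by rewrite ltr_pM2r //; lra.
nra.
Qed.

Lemma g_mono (R : realType) : {in `[0, pi] &, {mono (@g R) : x y / x < y}}.
Proof. by move=> x y x_in y_in; rewrite !gE ltrD2l ltrN2 ltr_pM2l // ltr_cos. Qed.

Lemma secular_node_sign (R : realType) (a s : R) n k : (0 < k < n)%N ->
  1 < a -> `|s| <= 2 * a ->
  0 < (-1) ^+ k * secular (a ^+ 2) s n (2 - g (k%:R * pi / n%:R)).
Proof.
move=> kn a1; rewrite gE opprB addrC subrK secular_cos // ler_norml => /andP[s1 s2].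
have : 0 < (a - 1) ^+ 2 by rewrite exprn_gt0 // subr_gt0.
rewrite -signr_odd; case: (odd k); rewrite ?expr1 ?expr0; lra.
Qed.

Lemma Re_le_normc (R : rcfType) (z : R[i]) : `|complex.Re z| <= normc z.
Proof. by rewrite -lecR; exact: normc_ge_Re. Qed.

Lemma node_in (R : realType) n k : (k <= n)%N -> (0 < n)%N ->
  k%:R * pi / n%:R \in `[0, pi : R].
Proof.
move=> kn n0; rewrite in_itv /= divr_ge0 ?mulr_ge0 ?pi_ge0 ?ler0n //=.
by rewrite ler_pdivrMr ?ltr0n // mulrC ler_pM2l ?pi_gt0 // ler_nat.
Qed.

Lemma ltr_node (R : realType) n k l : (k < l <= n)%N ->
  g (k%:R * pi / n%:R) < g (l%:R * pi / n%:R) :> R.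
Proof.
move=> /andP[kl ln]; have n0 : (0 < n)%N by lia.
rewrite g_mono ?node_in //; last by lia.
by rewrite ltr_pM2r ?invr_gt0 ?ltr0n // ltr_pM2r ?pi_gt0 // ltr_nat.
Qed.

(** The points [- (a + 1)] and [a + 5] correspond to [t = a + 3] and
    [t = - (a + 3)], where [secular_far_gt0] applies. *)
Lemma secular_root_localization (R : realType) (a s : R) n (i : 'I_n) :
  (1 < n)%N -> 1 < a -> `|s| <= 2 * a -> a + 1 < n%:R * (a - 1) ->
  exists x, secular (a ^+ 2) s n (2 - x) = 0 /\
    (if i == 0%N :> nat then x < 0 else
     if i == n.-1 :> nat then 4 < x else
     g (i%:R * pi / n%:R) < x < g (i.+1%:R * pi / n%:R)).
Proof.
move=> n1 a1 sa big; have n0 : (0 < n)%N by lia.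
have sa' : `|(-1) ^+ n * s| <= 2 * a by rewrite normrM normrX normrN1 expr1n mul1r.
have [i0|i0] := eqVneq (i : nat) 0%N.
  have [||x /andP[_ x0] rx] := @secular_root _ (a ^+ 2) s (- (a + 1)) 0 n.
  - lra.
  - rewrite subr0 pmulr_rlt0; first exact: secular_two_lt0.
    by rewrite (_ : 2 - _ = a + 3) ?secular_far_gt0 //; ring.
  by exists x.
have [iN|iN] := eqVneq (i : nat) n.-1.
  have [||x /andP[x4 _] rx] := @secular_root _ (a ^+ 2) s 4 (a + 5) n.
  - lra.
  - rewrite (_ : 2 - 4 = - 2); last by ring.
    rewrite (_ : 2 - (a + 5) = - (a + 3)); last by ring.
    set u := secular _ _ _ _; set v := secular _ _ _ _.
    have -> : u * v = ((-1) ^+ n * u) * ((-1) ^+ n * v).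
      by rewrite mulrACA -expr2 sqrr_sign mul1r.
    by rewrite !secular_opp // pmulr_llt0 ?secular_two_lt0 ?secular_far_gt0.
  by exists x.
have iI := ltn_ord i.
have [||x lxr rx] := @secular_root _ (a ^+ 2) s (g (i%:R * pi / n%:R))
    (g (i.+1%:R * pi / n%:R)) n.
- by rewrite ltr_node //; lia.
- have ki : (0 < i < n)%N by lia.
  have ki1 : (0 < i.+1 < n)%N by lia.
  rewrite -oppr_gt0.
  have := mulr_gt0 (secular_node_sign ki a1 sa) (secular_node_sign ki1 a1 sa).
  set u := secular _ _ _ _; set v := secular _ _ _ _.
  suff -> : (-1) ^+ i * u * ((-1) ^+ i.+1 * v) = - (u * v) by [].
  by rewrite mulrACA -exprD addnS addnn exprS -muln2 mulnC exprM sqrrN !expr1n; ring.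
by exists x.
Qed.

Theorem theorem4 (R : realType) (alpha : R[i]) (n : nat) :
  (3 <= n)%N -> 1 < normc alpha -> N2 alpha <= n%:R ->
  [/\ lambda alpha n 1 < 0,
      4 < lambda alpha n n &
      forall j : nat, (2 <= j <= n - 1)%N ->
        0 < lambda alpha n j < 4 /\
        g ((j%:R - 1) * pi / n%:R) < lambda alpha n j < g (j%:R * pi / n%:R)].
Proof.
move=> n3 a1 leN2; set a := normc alpha in a1 leN2 *.
have n0 : (0 < n)%N by lia.
have n1 : (1 < n)%N by lia.
have big := N2_large a1 leN2.
have sa : `|2 * complex.Re alpha| <= 2 * a.
  by rewrite normrM ger0_norm // ler_pM2l // Re_le_normc.
have hM := A_mx_hermitian alpha n3.
pose e k : R := g (k%:R * pi / n%:R).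
have e0 : e 0%N = 0 by rewrite /e !mul0r gE cos0; ring.
have eN : e n = 4.
  by rewrite /e mulrC mulrA mulVf ?pnatr_eq0 ?mul1r ?gE ?cospi ?gt_eqF //; ring.
have e_lt k l : (k < l <= n)%N -> e k < e l by exact: ltr_node.
have e_le k l : (k <= l <= n)%N -> e k <= e l.
  move=> /andP[]; rewrite leq_eqVlt => /predU1P[-> //|kl ln].
  by apply/ltW/e_lt; rewrite kl.
have [f fP] := fin_all_exists (fun i => secular_root_localization i n1 a1 sa big).
(* The extreme roots also satisfy the weak bounds by the nodes, as [e 0 = 0] and
   [e n = 4]; this makes the comparison of roots uniform in the index. *)
have f_up (i : 'I_n) : (i < n.-1)%N -> f i < e i.+1.
  move=> iN; have [_] := fP i; case: eqP => [->|_].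
    by move/lt_trans; apply; rewrite -e0 e_lt //; lia.
  by rewrite ltn_eqF // => /andP[].
have f_down (i : 'I_n) : (0 < i)%N -> e i < f i.
  move=> i0; have [_] := fP i; rewrite gtn_eqF //; case: eqP => [->|_].
    by apply: lt_trans; rewrite -eN e_lt //; lia.
  by case/andP.
have f_incr : {homo f : i k / (i < k)%N >-> i < k}.
  move=> i k ik; have kn := ltn_ord k.
  apply: lt_trans (f_up i _) _; first by lia.
  by apply: le_lt_trans (f_down k _); [apply: e_le|]; lia.
have f_eig i : f i \in eigvals (A_mx alpha n).
  by apply: mem_eigvals hM _; apply: A_mx_eigenvalue => //; case: (fP i).
have lamE (i : 'I_n) : lambda alpha n i.+1 = f i.
  apply: nth_sorted_increasing f_incr f_eig i; first exact: eigvals_sorted.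
  exact: size_eigvals.
split.
- by rewrite (lamE (Ordinal n0)); case: (fP (Ordinal n0)).
- have lN : (n.-1 < n)%N by lia.
  have := lamE (Ordinal lN); rewrite /= (prednK n0) => ->.
  by have [_] := fP (Ordinal lN); rewrite /= eqxx ifF //; lia.
- move=> j /andP[j2 jn]; have lj : (j.-1 < n)%N by lia.
  have := lamE (Ordinal lj); rewrite /= prednK; last by lia.
  move=> ->; set x := f _.
  have lo : e j.-1 < x by apply: (f_down (Ordinal lj)) => /=; lia.
  have up : x < e j by have := f_up (Ordinal lj); rewrite /= prednK; [apply|]; lia.
  have pred_j : (j%:R - 1 : R) = j.-1%:R.
    by rewrite -[in LHS](@prednK j) -?natr1 ?addrK //; lia.
  split; last by rewrite pred_j lo up.
  apply/andP; split.
    by apply: le_lt_trans lo; rewrite -e0 e_le //; lia.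
  by apply: lt_le_trans up _; rewrite -eN e_le //; lia.
Qed.
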